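(* Let $A$ be a commutative ring, $X_\bullet$ any simplicial $A$-module, $p\ge1$ and $j\in\{0,\dots,p\}$. Then the Moore filler map $\mu_j$ is a section of the horn map $\Phi_j$ (that is, $\Phi_j\circ\mu_j=\operatorname{id}_{\operatorname{Horns}(p,j)}$), and $$X_p=R_{p,j}(X)\oplus D_p(X).$$ In particular, $\operatorname{im}(\mu_j)=D_p(X)$.
   Context: Let $F_j=\{0,\dots,p\}\setminus\{j\}$. For a simplicial $A$-module $X_\bullet$ with faces $d_i$ and degeneracies $s_i$: - $R_{p,j}(X)=\bigcap_{i\in F_j}\ker(d_i:X_p\to X_{p-1})$ is the horn kernel, and $D_p(X)=\sum_{r=0}^{p-1}\operatorname{im}(s_r:X_{p-1}\to X_p)$ is the degenerate submodule. - $\operatorname{Horns}(p,j)$ is the submodule of $\prod_{i\in F_j}X_{p-1}$ of tuples $(x_i)_{i\in F_j}$ with $d_ix_\ell=d_{\ell-1}x_i$ for all $i<\ell$ with $i,\ell\in F_j$. - The horn map $\Phi_j:X_p\to\operatorname{Horns}(p,j)$ is $\Phi_j(T)=(d_iT)_{i\in F_j}$. - The Moore filler map $\mu_j:\operatorname{Horns}(p,j)\to D_p(X)\subseteq X_p$ is defined on $H=(x_i)_{i\in F_j}$ as follows. Phase I: $T^{(-1)}:=0$ and, for $i=0,1,\dots,j-1$ in increasing order, $T^{(i)}:=T^{(i-1)}+s_i\bigl(x_i-d_iT^{(i-1)}\bigr)$. Phase II: $U^{(p+1)}:=T^{(j-1)}$ and, for $i=p,p-1,\dots,j+1$ in decreasing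 order, $U^{(i)}:=U^{(i+1)}+s_{i-1}\bigl(x_i-d_iU^{(i+1)}\bigr)$. Output: $\mu_j(H):=U^{(j+1)}$. *)

(* Defs.v *)
From HB Require Import structures.
From mathcomp Require Import all_boot all_order all_algebra.
From mathcomp Require Import classical_sets.

Set Implicit Arguments.
Unset Strict Implicit.
Unset Printing Implicit Defensive.

Import GRing.Theory.
Local Open Scope classical_set_scope.
Local Open Scope ring_scope.

(* The indices in the simplicial identities are natural numbers, turned into
   ordinals by inord; the hypotheses keep every one of them within bounds, so
   that inord never truncates. *)
Record simplicialModule (A : comPzRingType) := SimplicialModule {
  simplex :> nat -> lmodType A;
  face : forall n, 'I_n.+2 -> {linear simplex n.+1 -> simplex n};
  degen : forall n, 'I_n.+1 -> {linear simplex n -> simplex n.+1};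
  face_face : forall n (i j : nat) (x : simplex n.+2),
    (i < j <= n.+2)%N ->
    face (inord i) (face (inord j) x) = face (inord j.-1) (face (inord i) x);
  degen_degen : forall n (i j : nat) (x : simplex n),
    (i <= j <= n)%N ->
    degen (inord i) (degen (inord j) x) =
    degen (inord j.+1) (degen (inord i) x);
  face_degen_lt : forall n (i j : nat) (x : simplex n.+1),
    (i < j <= n.+1)%N ->
    face (inord i) (degen (inord j) x) = degen (inord j.-1) (face (inord i) x);
  face_degen_id : forall n (i j : nat) (x : simplex n),
    (j <= n)%N -> (i == j) || (i == j.+1) ->
    face (inord i) (degen (inord j) x) = x;
  face_degen_gt : forall n (i j : nat) (x : simplex n.+1),
    (j.+1 < i <= n.+2)%N ->
    face (inord i) (degen (inord j) x) = degen (inord j) (face (inord i.-1) x)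
}.

(* Throughout, the dimension p >= 1 is written n.+1, so that p - 1 is n and
   {0, ..., p} is 'I_n.+2. *)

Definition hornIndex n (j : 'I_n.+2) := {i : 'I_n.+2 | i != j}.

Section Horns.
Variables (A : comPzRingType) (X : simplicialModule A).

(* For p = 1 the index set is a singleton, so there is no condition (and no
   module X_(p-2) in which to state one). *)
Definition horn_compatible n (j : 'I_n.+2) :
    {pred {ffun hornIndex j -> X n}} :=
  match n return forall j : 'I_n.+2, {pred {ffun hornIndex j -> X n}} with
  | 0 => fun _ => predT
  | m.+1 => fun j => [pred x : {ffun hornIndex j -> X m.+1} |
      [forall i : hornIndex j, forall l : hornIndex j,
        (val i < val l)%N ==>
        (face X (inord (val i)) (x l) == face X (inord (val l).-1) (x i))]]
  end j.
Arguments horn_compatible {n} j.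

Lemma horn_compatible_submod n (j : 'I_n.+2) :
  submod_closed (horn_compatible j).
Proof.
case: n j => [|m] j; first by split.
split=> [|a x y /forallP xP /forallP yP].
  by apply/forallP => i; apply/forallP => l; rewrite !ffunE !linear0 eqxx implybT.
apply/forallP => i; apply/forallP => l; apply/implyP => il.
have /forallP/(_ l)/implyP/(_ il)/eqP xE := xP i.
have /forallP/(_ l)/implyP/(_ il)/eqP yE := yP i.
by rewrite !ffunE !linearP xE yE.
Qed.

HB.instance Definition _ n (j : 'I_n.+2) :=
  GRing.isSubmodClosed.Build A {ffun hornIndex j -> X n} (horn_compatible j)
    (horn_compatible_submod j).

Record horns n (j : 'I_n.+2) := Horn {
  horn_val :> {ffun hornIndex j -> X n};
  _ : horn_val \in horn_compatible j
}.

HB.instance Definition _ n (j : 'I_n.+2) := [isSub for @horn_val n j].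
HB.instance Definition _ n (j : 'I_n.+2) := [Choice of horns j by <:].
HB.instance Definition _ n (j : 'I_n.+2) :=
  [SubChoice_isSubLmodule of horns j by <:].

Lemma horn_map_subproof n (j : 'I_n.+2) (T : X n.+1) :
  [ffun i : hornIndex j => face X (val i) T] \in horn_compatible j.
Proof.
case: n j T => [|m] j T; first by [].
apply/forallP => i; apply/forallP => l; apply/implyP => il.
rewrite !ffunE; apply/eqP.
by rewrite -[in LHS](inord_val (val l)) face_face ?inord_val // il -ltnS ltn_ord.
Qed.

Definition horn_map n (j : 'I_n.+2) (T : X n.+1) : horns j :=
  Horn (horn_map_subproof j T).

Definition horn_kernel n (j : 'I_n.+2) : set (X n.+1) :=
  \bigcap_(i in [set i : 'I_n.+2 | i != j]) [set T | face X i T = 0].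

Definition degenerate n : set (X n.+1) :=
  [set \sum_(r < n.+1) degen X r (y r) | y in [set: 'I_n.+1 -> X n]].

(* The component x_i for a natural number i; the value 0 is only taken at
   i = j and is never used below. *)
Definition horn_coord n (j : 'I_n.+2) (x : horns j) (i : nat) : X n :=
  oapp (horn_val x) 0 (insub (inord i)).

Definition moore_step n (j : 'I_n.+2) (x : horns j) (i r : nat)
    (T : X n.+1) : X n.+1 :=
  T + degen X (inord r) (horn_coord x i - face X (inord i) T).

Definition moore_phaseI n (j : 'I_n.+2) (x : horns j) : X n.+1 :=
  foldl (fun T i => moore_step x i i T) 0 (iota 0 j).

(* The list is p, p - 1, ..., j + 1. *)
Definition moore_filler n (j : 'I_n.+2) (x : horns j) : X n.+1 :=
  foldl (fun U i => moore_step x i i.-1 U) (moore_phaseI x)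
    (rev (iota j.+1 (n.+1 - j))).

End Horns.

Arguments horn_map {A} X {n} j.
Arguments horn_kernel {A} X {n} j.
Arguments degenerate {A} X n.
Arguments moore_filler {A} X {n} j.

Definition is_submodule (A : pzRingType) (M : lmodType A) (U : set M) :=
  [/\ U 0, forall u v, U u -> U v -> U (u + v)
    & forall (a : A) u, U u -> U (a *: u)].

(* M is the internal direct sum of its submodules U and V. *)
Definition internal_direct_sum (A : pzRingType) (M : lmodType A)
    (U V : set M) :=
  [/\ is_submodule U, is_submodule V,
      [set u + v | u in U & v in V] = [set: M]
    & U `&` V = [set 0]].

(* Main.v *)
Require Import Defs.
From mathcomp Require Import all_boot all_order all_algebra.
From mathcomp Require Import classical_sets.
From mathcomp Require Import zify.

Local Open Scope classical_set_scope.

(** Each step of the Moore filler corrects one face and, by the simplicial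
    identities and the compatibility of the horn, keeps the faces corrected
    before; hence the filler is a section of the horn map.  For the horn of a
    simplex [Y], the error [Y - T] evolves under a step by [1 - s_q d_i].  On
    [im s_r] these operators commute past [s_r] until the one with [q = r],
    which kills it, so the filler recovers every degenerate [Y] from its horn.
    Thus [mu_j \o Phi_j] is a projection onto [D_p] with kernel [R_(p,j)]. *)

Section MooreFiller.
Set Implicit Arguments.
Unset Strict Implicit.
Import GRing.Theory.
Local Open Scope ring_scope.

Variables (A : comPzRingType) (X : simplicialModule A).

(** * Horn coordinates indexed by natural numbers *)

Lemma horn_coordE n (j : 'I_n.+2) (x : horns X j) (i : hornIndex j) :
  horn_coord x (val i) = horn_val x i.
Proof. by rewrite /horn_coord inord_val valK. Qed.

Lemma horn_coord_map n (j : 'I_n.+2) (Y : X n.+1) (i : nat) :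
  (i <= n.+1)%N -> i != j :> nat ->
  horn_coord (horn_map X j Y) i = face X (inord i) Y.
Proof.
move=> le_i ne_ij.
have ij : inord i != j by rewrite -val_eqE /= inordK.
by rewrite /horn_coord insubT /= ffunE.
Qed.

Lemma horn_coord_compatible n (j : 'I_n.+3) (x : horns X j) (i l : nat) :
  (i < l <= n.+2)%N -> i != j :> nat -> l != j :> nat ->
  face X (inord i) (horn_coord x l) = face X (inord l.-1) (horn_coord x i).
Proof.
move=> /andP[il le_l] ne_ij ne_lj.
have ij : inord i != j by rewrite -val_eqE /= inordK //; lia.
have lj : inord l != j by rewrite -val_eqE /= inordK.
rewrite /horn_coord !insubT /=.
case: x => x /= /forallP/(_ (Sub (inord i) ij))/forallP/(_ (Sub (inord l) lj)).
by rewrite !SubK !inordK //; [rewrite il => /eqP | lia].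
Qed.

(** * Faces of the filler *)

Lemma face_moore_step_id n (j : 'I_n.+2) (x : horns X j) (i r : nat)
    (T : X n.+1) :
  (r <= n)%N -> (i == r) || (i == r.+1) ->
  face X (inord i) (moore_step x i r T) = horn_coord x i.
Proof.
by move=> le_r ir; rewrite /moore_step linearD face_degen_id // addrC subrK.
Qed.

(** Moving [d_k] past [s_r] turns the [k]-th face of the correction into a degeneracy of
    [d_k (x_i - d_i T)] or [d_(k-1) (x_i - d_i T)], which vanishes by horn compatibility and
    [d_k T = x_k]. The first index case serves phase I and the faces below [j] in phase II, the
    second the faces already corrected in phase II. *)
Lemma face_moore_step n (j : 'I_n.+2) (x : horns X j) (i r k : nat)
    (T : X n.+1) :
  i != j :> nat -> k != j :> nat ->
  (r <= n)%N -> (i <= n.+1)%N -> (k <= n.+1)%N ->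
  (k < i)%N && (k < r)%N || (i < k)%N && (r.+1 < k)%N ->
  face X (inord k) T = horn_coord x k ->
  face X (inord k) (moore_step x i r T) = horn_coord x k.
Proof.
(* In dimension 1 the index conditions contradict each other; above it, iterated faces make
   sense. *)
case: n j x T => [|n] j x T ne_ij ne_kj le_r le_i le_k kir Tk; first by lia.
rewrite /moore_step linearD Tk; case/orP: kir => /andP[ki kr].
  rewrite face_degen_lt ?kr // linearB.
  rewrite (@horn_coord_compatible _ _ _ k i) ?ki //.
  by rewrite face_face ?ki // Tk subrr linear0 addr0.
rewrite face_degen_gt ?kr // linearB -(@horn_coord_compatible _ _ _ i k) ?ki //.
by rewrite -face_face ?ki // Tk subrr linear0 addr0.
Qed.

Lemma face_phaseI n (j : 'I_n.+2) (x : horns X j) (m k : nat) :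
  (k < m <= j)%N ->
  face X (inord k) (foldl (fun T i => moore_step x i i T) 0 (iota 0 m)) =
  horn_coord x k.
Proof.
have le_j := ltn_ord j.
elim: m => [|m IH] /andP[km mj] //.
rewrite -[m.+1]addn1 iotaD foldl_cat add0n /=.
have [lt_km|le_mk] := ltnP k m.
  by apply: face_moore_step; try lia; apply: IH; lia.
have -> : k = m by lia.
by apply: face_moore_step_id; lia.
Qed.

(** The order is decreasing, so [a] is corrected last and the induction removes that step. For
    [k < j], the bound [j < a] gives [k < a.-1], so the faces from phase I survive. *)
Lemma face_phaseII n (j : 'I_n.+2) (x : horns X j) (U : X n.+1) (m a k : nat) :
  (forall i, (i < j)%N -> face X (inord i) U = horn_coord x i) ->
  (a + m)%N = n.+2 -> (j < a)%N -> (k <= n.+1)%N ->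
  (k < j)%N || (a <= k)%N ->
  face X (inord k)
    (foldl (fun T i => moore_step x i i.-1 T) U (rev (iota a m))) =
  horn_coord x k.
Proof.
move=> U_j; elim: m a => [|m IH] a am ja le_k kja /=; first by apply: U_j; lia.
rewrite rev_cons foldl_rcons.
have [->|ne_ka] := eqVneq k a; first by apply: face_moore_step_id; lia.
by apply: face_moore_step; try lia; apply: IH; lia.
Qed.

Lemma moore_fillerK n (j : 'I_n.+2) : cancel (moore_filler X j) (horn_map X j).
Proof.
move=> x; apply: val_inj; apply/ffunP => i; rewrite ffunE -horn_coordE.
rewrite -[in LHS](inord_val (val i)); have le_j := ltn_ord j.
have le_i := ltn_ord (val i); have : val i != j :> nat := valP i.
move=> ne_ij; apply: face_phaseII; try lia.
by move=> k kj; apply: face_phaseI; rewrite kj leqnn.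
Qed.

(** * Recovering degenerate simplices from their horns *)

Definition moore_defect n (i r : nat) (T : X n.+1) : X n.+1 :=
  T - degen X (inord r) (face X (inord i) T).

(** The projection complementary to [mu_j \o Phi_j], written as a composite of linear operators so
    that it can be evaluated on one degeneracy at a time. *)
Definition moore_projector n (j : 'I_n.+2) (Y : X n.+1) : X n.+1 :=
  foldl (fun T i => moore_defect i i.-1 T)
    (foldl (fun T i => moore_defect i i T) Y (iota 0 j))
    (rev (iota j.+1 (n.+1 - j))).

(** For [i != j] the coordinate [x_i] is [d_i Y], so the correction is [s_(f i) d_i (Y - T)]. Here
    [f] is the identity in phase I and the predecessor in phase II. *)
Lemma foldl_moore_step_horn_map n (j : 'I_n.+2) (f : nat -> nat)
    (Y T : X n.+1) (s : seq nat) :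
  all (fun i => (i <= n.+1)%N && (i != j)) s ->
  Y - foldl (fun T i => moore_step (horn_map X j Y) i (f i) T) T s =
  foldl (fun T i => moore_defect i (f i) T) (Y - T) s.
Proof.
elim: s T => //= i s IH T /andP[/andP[le_i ij] s_ok]; rewrite IH //.
congr foldl; rewrite /moore_step /moore_defect horn_coord_map //.
by rewrite -linearB opprD addrA.
Qed.

Lemma moore_projectorE n (j : 'I_n.+2) (Y : X n.+1) :
  moore_projector j Y = Y - moore_filler X j (horn_map X j Y).
Proof.
have le_j := ltn_ord j; rewrite /moore_filler /moore_phaseI.
rewrite foldl_moore_step_horn_map; last first.
  by apply/allP => i; rewrite mem_rev mem_iota => ?; lia.
rewrite (@foldl_moore_step_horn_map _ _ id) ?subr0 //.
by apply/allP => i; rewrite mem_iota => ?; lia.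
Qed.

Lemma foldl_moore_defect_sum n (f : nat -> nat) (s : seq nat) (I : finType)
    (F : I -> X n.+1) :
  foldl (fun T i => moore_defect i (f i) T) (\sum_k F k) s =
  \sum_k foldl (fun T i => moore_defect i (f i) T) (F k) s.
Proof.
elim: s F => //= i s IH F; rewrite -IH; congr foldl.
by rewrite /moore_defect sumrB !linear_sum.
Qed.

Lemma foldl_moore_defect0 n (f : nat -> nat) (s : seq nat) :
  foldl (fun T i => moore_defect i (f i) T) (0 : X n.+1) s = 0.
Proof.
elim: s => //= i s.
by rewrite [moore_defect _ _ 0]/moore_defect !linear0 addr0.
Qed.

Lemma moore_defect_degen_id n (i r : nat) (y : X n) :
  (r <= n)%N -> (i == r) || (i == r.+1) ->
  moore_defect i r (degen X (inord r) y) = 0.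
Proof. by move=> le_r ir; rewrite /moore_defect face_degen_id // subrr. Qed.

(** Here [d_i s_r = s_(r-1) d_i] and [s_i s_(r-1) = s_r s_i], so [1 - s_i d_i] passes through [s_r]
    unchanged. *)
Lemma moore_defect_degen_lt n (i r : nat) (y : X n) :
  (i < r <= n)%N ->
  exists z, moore_defect i i (degen X (inord r) y) = degen X (inord r) z.
Proof.
case: n y => [|n] y /andP[ir le_r]; first by lia.
exists (y - degen X (inord i) (face X (inord i) y)).
rewrite /moore_defect face_degen_lt ?ir // degen_degen; last by lia.
by rewrite linearB prednK //; lia.
Qed.

(** Here [d_i s_r = s_r d_(i-1)] and [s_(i-1) s_r = s_r s_(i-2)], so the operator passes through
    [s_r] with both indices lowered by one. *)
Lemma moore_defect_degen_gt n (i r : nat) (y : X n) :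
  (r.+1 < i <= n.+1)%N ->
  exists z, moore_defect i i.-1 (degen X (inord r) y) = degen X (inord r) z.
Proof.
case: n y => [|n] y /andP[ri le_i]; first by lia.
exists (y - degen X (inord i.-2) (face X (inord i.-1) y)).
rewrite /moore_defect face_degen_gt ?ri // linearB.
rewrite (degen_degen (i := r) (j := i.-2)); last by lia.
by rewrite prednK //; lia.
Qed.

Lemma foldl_moore_defect_degen n (f : nat -> nat) (s : seq nat) (r : nat)
    (y : X n) :
  (forall i y, i \in s ->
    exists z : X n,
      moore_defect i (f i) (degen X (inord r) y) = degen X (inord r) z) ->
  exists z, foldl (fun T i => moore_defect i (f i) T) (degen X (inord r) y) s =
    degen X (inord r) z.
Proof.
elim: s y => [|i s IH] y s_ok /=; first by exists y.
have [z ->] := s_ok i y (mem_head _ _).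
by apply: IH => k u ks; apply: s_ok; rewrite inE ks orbT.
Qed.

Lemma moore_projector_degen n (j : 'I_n.+2) (r : nat) (y : X n) :
  (r <= n)%N -> moore_projector j (degen X (inord r) y) = 0.
Proof.
move=> le_r; have le_j := ltn_ord j; rewrite /moore_projector.
have [rj|jr] := ltnP r j.
  (* If [r < j], phase I reaches [i = r], where [d_r s_r = 1] kills the error. *)
  have -> : iota 0 j = iota 0 r ++ r :: iota r.+1 (j - r.+1).
    rewrite -[r :: _]/(iota r (j - r.+1).+1).
    by rewrite -[X in iota X _.+1]add0n -iotaD; congr iota; lia.
  rewrite foldl_cat /=.
  have [|z ->] := @foldl_moore_defect_degen _ id (iota 0 r) r y.
    by move=> i u; rewrite mem_iota => ir; apply: moore_defect_degen_lt; lia.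
  rewrite moore_defect_degen_id ?eqxx //.
  by rewrite (@foldl_moore_defect0 _ id) foldl_moore_defect0.
have [|z ->] := @foldl_moore_defect_degen _ id (iota 0 j) r y.
  by move=> i u; rewrite mem_iota => ij; apply: moore_defect_degen_lt; lia.
(* If [j <= r], all of phase I stays in the image of [s_r], as do the steps [i > r.+1] that open
   phase II; then [i = r.+1] kills the error. *)
have -> : iota j.+1 (n.+1 - j) =
    iota j.+1 (r - j) ++ r.+1 :: iota r.+2 (n - r).
  rewrite -[r.+1 :: _]/(iota r.+1 (n - r).+1).
  have -> : r.+1 = (j.+1 + (r - j))%N by lia.
  by rewrite -iotaD; congr iota; lia.
rewrite rev_cat rev_cons cat_rcons foldl_cat /=.
have [|w ->] := @foldl_moore_defect_degen _ predn (rev (iota r.+2 (n - r))) r z.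
  move=> i u; rewrite mem_rev mem_iota => ri.
  by apply: moore_defect_degen_gt; lia.
by rewrite moore_defect_degen_id ?eqxx ?orbT // foldl_moore_defect0.
Qed.

Lemma horn_mapK_degenerate n (j : 'I_n.+2) (Y : X n.+1) :
  degenerate X n Y -> moore_filler X j (horn_map X j Y) = Y.
Proof.
case=> y _ <-; apply/esym/eqP; rewrite -subr_eq0 -moore_projectorE.
rewrite /moore_projector (@foldl_moore_defect_sum _ id) foldl_moore_defect_sum.
apply/eqP/big1 => r _; rewrite -[r in degen X r](inord_val r).
by apply: moore_projector_degen; rewrite -ltnS.
Qed.

(** * The two summands as submodules *)

Lemma degenerate_submodule n : is_submodule (degenerate X n).
Proof.
split=> [|_ _ [y _ <-] [z _ <-]|a _ [y _ <-]].
- by exists (fun=> 0) => //; apply: big1 => r _; rewrite linear0.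
- exists (fun r => y r + z r) => //; rewrite -big_split.
  by apply: eq_bigr => r _; rewrite linearD.
- exists (fun r => a *: y r) => //; rewrite scaler_sumr.
  by apply: eq_bigr => r _; rewrite linearZ.
Qed.

Lemma degenerate_degen n (r : 'I_n.+1) (y : X n) :
  degenerate X n (degen X r y).
Proof.
exists (fun k => if k == r then y else 0) => //.
rewrite (bigD1 r) //= eqxx big1 ?addr0 // => k /negbTE->.
by rewrite linear0.
Qed.

Lemma degenerate_moore_filler n (j : 'I_n.+2) (x : horns X j) :
  degenerate X n (moore_filler X j x).
Proof.
have [D0 DD _] := degenerate_submodule n.
have D_foldl (f : nat -> nat) s T : degenerate X n T ->
    degenerate X n (foldl (fun T i => moore_step x i (f i) T) T s).
  elim: s T => //= i s IH T DT; apply/IH/DD => //.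
  exact: degenerate_degen.
exact/D_foldl/(D_foldl id).
Qed.

Lemma horn_kernel_submodule n (j : 'I_n.+2) : is_submodule (horn_kernel X j).
Proof.
split=> [i _|u v Ru Rv i ij|a u Ru i ij] /=; first by rewrite linear0.
- by rewrite linearD (Ru i ij) (Rv i ij) addr0.
- by rewrite linearZ /= (Ru i ij) scaler0.
Qed.

(** Writing the zero horn as the horn of [0] allows rewriting under [moore_filler] without linearity
    of [horn_map]. *)
Lemma horn_kernelP n (j : 'I_n.+2) (Y : X n.+1) :
  horn_kernel X j Y <-> horn_map X j Y = horn_map X j 0.
Proof.
split=> [RY|Y0 i ij].
  apply: val_inj; apply/ffunP => i; rewrite !ffunE linear0.
  exact: RY (valP i).
have /ffunP/(_ (Sub i ij)) := congr1 val Y0.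
by rewrite !ffunE linear0.
Qed.

End MooreFiller.

Theorem theorem6p2 (A : comPzRingType) (X : simplicialModule A) (n : nat)
    (j : 'I_n.+2) :
  [/\ cancel (moore_filler X j) (horn_map X j),
      internal_direct_sum (horn_kernel X j) (degenerate X n)
    & range (moore_filler X j) = degenerate X n].
Proof.
have [D0 _ _] := degenerate_submodule X n.
have [R0 _ _] := horn_kernel_submodule X j.
split; first exact: moore_fillerK.
  split; [exact: horn_kernel_submodule | exact: degenerate_submodule | |].
  - apply/seteqP; split=> // Y _; set T := moore_filler X j (horn_map X j Y).
    (* By the section property [Y] and [T] have the same horn, so [Y - T] lies in the horn
       kernel. *)
    exists (Y - T)%R; last first.
      by exists T; [exact: degenerate_moore_filler | exact: GRing.subrK].
    move=> i ij /=; apply/eqP; rewrite GRing.linearB GRing.subr_eq0; apply/eqP.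
    have /ffunP/(_ (Sub i ij)) :=
      congr1 val (moore_fillerK (horn_map X j Y)).
    by rewrite !ffunE.
  - apply/seteqP; split=> [Y [/horn_kernelP RY DY] /=|_ ->]; last by [].
    (* Both [Y] and [0] are degenerate with the same horn, and the filler recovers each from it. *)
    by rewrite -(horn_mapK_degenerate j DY) RY horn_mapK_degenerate.
apply/seteqP; split=> [_ [x _ <-]|Y DY]; first exact: degenerate_moore_filler.
by exists (horn_map X j Y) => //; apply: horn_mapK_degenerate.
Qed.
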